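(* Let $\mathcal{G}$ be a magmoidal category. The functor $L:\mathcal{N}_l(\mathcal{G})\to\mathrm{End}(\mathcal{G})$, $L(A,a)(X)=A\otimes X$, equipped with the natural isomorphisms $$L_{(A,a),(B,b)}:L((A,a)\otimes(B,b))\to L(A,a)\circ L(B,b),\qquad L_{(A,a),(B,b)}(X)=a_{B,X}^{-1}:(A\otimes B)\otimes X\to A\otimes(B\otimes X),$$ is semigroupal.
   Context: A magmoidal category is a category $\mathcal{G}$ with a functor $\otimes:\mathcal{G}\times\mathcal{G}\to\mathcal{G}$, with no associativity or unit condition. A semigroupal category is a magmoidal category with a natural associativity isomorphism $\phi_{X,Y,Z}:X\otimes(Y\otimes Z)\to(X\otimes Y)\otimes Z$ satisfying the pentagon axiom. A semigroupal functor $F:(\mathcal{C},\phi)\to(\mathcal{D},\psi)$ is a functor with natural isomorphisms $F_{X,Y}:F(X\otimes Y)\to F(X)\otimes F(Y)$ satisfying $\psi_{F(X),F(Y),F(Z)}\circ(F(X)\otimes F_{Y,Z})\circ F_{X,Y\otimes Z}=(F_{X,Y}\otimes F(Z))\circ F_{X\otimes Y,Z}\circ F(\phi_{X,Y,Z})$. An object's name also denotes its identity morphism. $\mathrm{End}(\mathcal{G})$ is the category of endofunctors of $\mathcal{G}$ and natural transformations, strict monoidal under composition of functors. The left nucleus $\mathcal{N}_l(\mathcal{G})$ has as objects pairs $(A,a)$, with $A\in\mathcal{G}$ and $a$ a family of isomorphisms $a_{X,Y}:A\otimes(X\otimes Y)\to(A\otimes X)\otimes Y$ natural in $X,Y$.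 A morphism $(A,a)\to(B,b)$ is a morphism $f:A\to B$ of $\mathcal{G}$ such that $((f\otimes X)\otimes Y)\circ a_{X,Y}=b_{X,Y}\circ(f\otimes(X\otimes Y))$ for all $X,Y$. It is semigroupal with $(A,a)\otimes(B,b)=(A\otimes B,a|b)$, where $(a|b)_{X,Y}\circ a_{B,X\otimes Y}=(a_{B,X}\otimes Y)\circ a_{B\otimes X,Y}\circ(A\otimes b_{X,Y})$, with the tensor product of morphisms taken in $\mathcal{G}$, and with associativity constraint $\phi_{(A,a),(B,b),(C,c)}=a_{B,C}$. On morphisms, $L(f)_X=f\otimes X$. *)

(* Defs.v *)
From Corelib Require Import ssreflect.
From Stdlib Require Import FunctionalExtensionality ProofIrrelevance.

Set Implicit Arguments.
Unset Strict Implicit.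
Unset Printing Implicit Defensive.

Declare Scope cat_scope.
Delimit Scope cat_scope with cat.
Local Open Scope cat_scope.

Record category := Category {
  ob :> Type;
  hom : ob -> ob -> Type;
  idm : forall X, hom X X;
  comp : forall X Y Z, hom Y Z -> hom X Y -> hom X Z;
  comp_idl : forall X Y (f : hom X Y), comp (idm Y) f = f;
  comp_idr : forall X Y (f : hom X Y), comp f (idm X) = f;
  comp_assoc : forall W X Y Z (h : hom Y Z) (g : hom X Y) (f : hom W X),
    comp h (comp g f) = comp (comp h g) f
}.
Arguments idm {c} X.
Arguments comp {c X Y Z} g f.

Notation "g ∘ f" := (comp g f) (at level 40, left associativity) : cat_scope.

Definition is_iso (C : category) (X Y : C) (f : hom X Y) : Prop :=
  exists g : hom Y X, g ∘ f = idm X /\ f ∘ g = idm Y.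

Record iso (C : category) (X Y : C) := Iso {
  fwd :> hom X Y;
  inv : hom Y X;
  invK : inv ∘ fwd = idm X;
  fwdK : fwd ∘ inv = idm Y
}.

Record functor (C D : category) := Functor {
  fob :> C -> D;
  fmap : forall X Y, hom X Y -> hom (fob X) (fob Y);
  fmap_id : forall X, fmap (idm X) = idm (fob X);
  fmap_comp : forall X Y Z (g : hom Y Z) (f : hom X Y),
    fmap (g ∘ f) = fmap g ∘ fmap f
}.
Arguments fmap {C D} f0 {X Y} f.

Record nat_trans (C D : category) (F G : functor C D) := NatTrans {
  component :> forall X : C, hom (F X) (G X);
  naturality : forall X Y (f : hom X Y),
    component Y ∘ fmap F f = fmap G f ∘ component X
}.

Lemma nat_trans_ext (C D : category) (F G : functor C D)
  (s t : nat_trans F G) : (forall X, s X = t X) -> s = t.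
Proof.
case: s t => [s sP] [t tP] /= st.
have e : s = t by apply: functional_extensionality_dep.
by case: _ / e tP => tP; rewrite (proof_irrelevance _ sP tP).
Qed.

Definition prod_category (C D : category) : category.
Proof.
refine (@Category (C * D)%type
  (fun X Y => (hom (fst X) (fst Y) * hom (snd X) (snd Y))%type)
  (fun X => (idm (fst X), idm (snd X)))
  (fun X Y Z g f => (fst g ∘ fst f, snd g ∘ snd f)) _ _ _).
- by move=> X Y [f g] /=; rewrite !comp_idl.
- by move=> X Y [f g] /=; rewrite !comp_idr.
- by move=> W X Y Z [h h'] [g g'] [f f'] /=; rewrite !comp_assoc.
Defined.

Definition functor_comp (C D E : category) (F : functor D E) (G : functor C D) :
  functor C E.
Proof.
refine (@Functor C E (fun X => F (G X)) (fun X Y f => fmap F (fmap G f)) _ _).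
- by move=> X; rewrite !fmap_id.
- by move=> X Y Z g f; rewrite !fmap_comp.
Defined.

Record magmoidal := Magmoidal {
  mcat :> category;
  tensor : functor (prod_category mcat mcat) mcat
}.

Definition tens_ob (G : magmoidal) (X Y : G) : G := tensor G (X, Y).

Notation "X ⊗ Y" := (tens_ob X Y) (at level 38, left associativity) : cat_scope.

(* ⊠ is the action of the functor ⊗ on morphisms. *)
Definition tens_hom (G : magmoidal) (X X' Y Y' : G)
    (f : hom X X') (g : hom Y Y') : hom (X ⊗ Y) (X' ⊗ Y') :=
  @fmap _ _ (tensor G) (X, Y) (X', Y') (f, g).

Notation "f ⊠ g" := (tens_hom f g) (at level 38, left associativity) : cat_scope.

Record semigroupal := Semigroupal {
  smag :> magmoidal;
  assoc : forall X Y Z : smag, iso (X ⊗ (Y ⊗ Z)) ((X ⊗ Y) ⊗ Z);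
  assoc_nat : forall (X X' Y Y' Z Z' : smag)
    (f : hom X X') (g : hom Y Y') (h : hom Z Z'),
    assoc X' Y' Z' ∘ (f ⊠ (g ⊠ h)) = ((f ⊠ g) ⊠ h) ∘ assoc X Y Z;
  pentagon : forall X Y Z W : smag,
    assoc (X ⊗ Y) Z W ∘ assoc X Y (Z ⊗ W)
    = (assoc X Y Z ⊠ idm W) ∘ assoc X (Y ⊗ Z) W ∘ (idm X ⊠ assoc Y Z W)
}.

Record is_semigroupal_functor (C D : semigroupal) (F : functor C D)
    (F2 : forall X Y : C, hom (F (X ⊗ Y)) (F X ⊗ F Y)) : Prop := {
  semigroupal_nat : forall (X X' Y Y' : C) (f : hom X X') (g : hom Y Y'),
    F2 X' Y' ∘ fmap F (f ⊠ g) = (fmap F f ⊠ fmap F g) ∘ F2 X Y;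
  semigroupal_iso : forall X Y : C, is_iso (F2 X Y);
  semigroupal_coh : forall X Y Z : C,
    assoc (F X) (F Y) (F Z) ∘ (idm (F X) ⊠ F2 Y Z) ∘ F2 X (Y ⊗ Z)
    = (F2 X Y ⊠ idm (F Z)) ∘ F2 (X ⊗ Y) Z ∘ fmap F (assoc X Y Z)
}.

Arguments is_semigroupal_functor {C D} F F2.

Section Calculus.
Variable G : magmoidal.

Lemma tens_comp (X X' X'' Y Y' Y'' : G) (g : hom X' X'') (f : hom X X')
    (k : hom Y' Y'') (h : hom Y Y') :
  (g ⊠ k) ∘ (f ⊠ h) = (g ∘ f) ⊠ (k ∘ h).
Proof. by rewrite /tens_hom -fmap_comp. Qed.

Lemma tens_id (X Y : G) : idm X ⊠ idm Y = idm (X ⊗ Y).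
Proof. exact: (fmap_id (tensor G) (X, Y)). Qed.

Definition iso_id (X : G) : iso X X :=
  Iso (comp_idl (idm X)) (comp_idl (idm X)).

Definition iso_sym (X Y : G) (i : iso X Y) : iso Y X :=
  Iso (fwdK i) (invK i).

Definition iso_comp (X Y Z : G) (j : iso Y Z) (i : iso X Y) : iso X Z.
Proof.
refine (@Iso _ _ _ (j ∘ i) (inv i ∘ inv j) _ _).
- by rewrite comp_assoc -(comp_assoc (inv i)) invK comp_idr invK.
- by rewrite comp_assoc -(comp_assoc j) fwdK comp_idr fwdK.
Defined.

Definition iso_tens (X X' Y Y' : G) (i : iso X X') (j : iso Y Y') :
  iso (X ⊗ Y) (X' ⊗ Y').
Proof.
refine (@Iso _ _ _ (i ⊠ j) (inv i ⊠ inv j) _ _).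
- by rewrite tens_comp !invK tens_id.
- by rewrite tens_comp !fwdK tens_id.
Defined.

Lemma iso_epi (X Y Z : G) (i : iso X Y) (f g : hom Y Z) :
  f ∘ i = g ∘ i -> f = g.
Proof.
move=> e; rewrite -(comp_idr f) -(comp_idr g) -(fwdK i).
by rewrite 2!comp_assoc e.
Qed.

Lemma inv_nat (X X' Y Y' : G) (i : iso X Y) (j : iso X' Y')
    (f : hom X X') (g : hom Y Y') :
  j ∘ f = g ∘ i -> inv j ∘ g = f ∘ inv i.
Proof.
move=> e; apply: (@iso_epi _ _ _ i).
rewrite -comp_assoc -e comp_assoc invK comp_idl.
by rewrite -comp_assoc invK comp_idr.
Qed.

End Calculus.

Section Endofunctors.
Variable C : category.

Definition nat_id (F : functor C C) : nat_trans F F.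
Proof.
refine (@NatTrans C C F F (fun X => idm (F X)) _).
by move=> X Y f; rewrite comp_idl comp_idr.
Defined.

Definition nat_comp (F G H : functor C C) (t : nat_trans G H)
  (s : nat_trans F G) : nat_trans F H.
Proof.
refine (@NatTrans C C F H (fun X => t X ∘ s X) _).
move=> X Y f.
by rewrite -comp_assoc naturality comp_assoc naturality comp_assoc.
Defined.

Definition End_category : category.
Proof.
refine (@Category (functor C C) (@nat_trans C C) nat_id nat_comp _ _ _).
- by move=> F G s; apply: nat_trans_ext => X /=; apply: comp_idl.
- by move=> F G s; apply: nat_trans_ext => X /=; apply: comp_idr.
- by move=> F G H K u t s; apply: nat_trans_ext => X /=; apply: comp_assoc.
Defined.

Definition nat_hcomp (F F' G G' : functor C C)
    (s : nat_trans F F') (t : nat_trans G G') :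
  nat_trans (functor_comp F G) (functor_comp F' G').
Proof.
refine (@NatTrans C C (functor_comp F G) (functor_comp F' G')
  (fun X => s (G' X) ∘ fmap F (t X)) _).
move=> X Y f /=.
by rewrite -comp_assoc -fmap_comp (naturality t) fmap_comp comp_assoc naturality
           -comp_assoc.
Defined.

Definition End_tensor : functor (prod_category End_category End_category) End_category.
Proof.
refine (@Functor (prod_category End_category End_category) End_category
  (fun FG => functor_comp (fst FG) (snd FG))
  (fun FG FG' st => nat_hcomp (fst st) (snd st)) _ _).
- move=> [F G]; apply: nat_trans_ext => X /=.
  by rewrite fmap_id comp_idl.
- move=> [F G] [F' G'] [F'' G''] [s' t'] [s t]; apply: nat_trans_ext => X /=.
  rewrite fmap_comp -comp_assoc (comp_assoc (component s _)) (naturality s).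
  by rewrite !comp_assoc.
Defined.

Definition End_magmoidal : magmoidal := Magmoidal End_tensor.

Lemma functor_comp_strict (F G H : functor C C) :
  functor_comp F (functor_comp G H) = functor_comp (functor_comp F G) H.
Proof.
by rewrite /functor_comp; congr Functor; apply: proof_irrelevance.
Qed.

(* Strictness: the two composites [functor_comp F (functor_comp G H)] and
   [functor_comp (functor_comp F G) H] have convertible actions on objects and
   morphisms, so the identity constraint of the strict structure is the
   transformation whose components are identities of C. *)
Definition End_assoc_fwd (F G H : functor C C) :
  nat_trans (functor_comp F (functor_comp G H))
            (functor_comp (functor_comp F G) H).
Proof.
refine (@NatTrans C C (functor_comp F (functor_comp G H))
  (functor_comp (functor_comp F G) H) (fun X => idm (F (G (H X)))) _).
by move=> X Y f /=; rewrite comp_idl comp_idr.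
Defined.

Definition End_assoc_inv (F G H : functor C C) :
  nat_trans (functor_comp (functor_comp F G) H)
            (functor_comp F (functor_comp G H)).
Proof.
refine (@NatTrans C C (functor_comp (functor_comp F G) H)
  (functor_comp F (functor_comp G H)) (fun X => idm (F (G (H X)))) _).
by move=> X Y f /=; rewrite comp_idl comp_idr.
Defined.

Definition End_assoc (F G H : End_magmoidal) :
  iso (F ⊗ (G ⊗ H)) ((F ⊗ G) ⊗ H).
Proof.
refine (@Iso End_magmoidal _ _ (End_assoc_fwd F G H) (End_assoc_inv F G H) _ _);
  by apply: nat_trans_ext => X /=; rewrite comp_idl.
Defined.

Definition End_semigroupal : semigroupal.
Proof.
refine (@Semigroupal End_magmoidal End_assoc _ _).
- move=> F F' G G' H H' s t u; apply: nat_trans_ext => X /=.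
  by rewrite comp_idl comp_idr fmap_comp comp_assoc.
- move=> F G H K; apply: nat_trans_ext => X /=.
  by rewrite !fmap_id !comp_idl.
Defined.

End Endofunctors.

Section LeftNucleus.
Variable G : magmoidal.

Record nuc_ob := NucOb {
  nob :> G;
  nass : forall X Y : G, iso (nob ⊗ (X ⊗ Y)) ((nob ⊗ X) ⊗ Y);
  nass_nat : forall (X X' Y Y' : G) (f : hom X X') (g : hom Y Y'),
    nass X' Y' ∘ (idm nob ⊠ (f ⊠ g)) = ((idm nob ⊠ f) ⊠ g) ∘ nass X Y
}.

Record nuc_hom (A B : nuc_ob) := NucHom {
  nfun :> hom (nob A) (nob B);
  nfunP : forall X Y : G,
    ((nfun ⊠ idm X) ⊠ idm Y) ∘ nass A X Y
    = nass B X Y ∘ (nfun ⊠ idm (X ⊗ Y))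
}.

Lemma nuc_hom_ext (A B : nuc_ob) (f g : nuc_hom A B) :
  nfun f = nfun g -> f = g.
Proof.
case: f g => [f fP] [g gP] /= e.
by case: _ / e gP => gP; rewrite (proof_irrelevance _ fP gP).
Qed.

Definition nuc_id (A : nuc_ob) : nuc_hom A A.
Proof.
refine (@NucHom A A (idm (nob A)) _).
by move=> X Y; rewrite !tens_id comp_idl comp_idr.
Defined.

Definition nuc_comp (A B C : nuc_ob) (g : nuc_hom B C) (f : nuc_hom A B) :
  nuc_hom A C.
Proof.
refine (@NucHom A C (nfun g ∘ nfun f) _).
move=> X Y.
rewrite -{1}(comp_idl (idm X)) -{1}(comp_idl (idm Y)) -!tens_comp.
rewrite -comp_assoc nfunP comp_assoc nfunP -comp_assoc tens_comp.
by rewrite comp_idl.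
Defined.

Definition nuc_category : category.
Proof.
refine (@Category nuc_ob nuc_hom nuc_id nuc_comp _ _ _).
- by move=> A B f; apply: nuc_hom_ext; apply: comp_idl.
- by move=> A B f; apply: nuc_hom_ext; apply: comp_idr.
- by move=> A B C D h g f; apply: nuc_hom_ext; apply: comp_assoc.
Defined.

Lemma nuc_nat (A B : nuc_ob) (f : nuc_hom A B) (X X' Y Y' : G)
    (g : hom X X') (h : hom Y Y') :
  nass B X' Y' ∘ (nfun f ⊠ (g ⊠ h)) = ((nfun f ⊠ g) ⊠ h) ∘ nass A X Y.
Proof.
rewrite -{1}(comp_idr (nfun f)) -{1}(comp_idl (g ⊠ h)) -tens_comp.
rewrite comp_assoc -nfunP -comp_assoc nass_nat comp_assoc !tens_comp.
by rewrite comp_idr !comp_idl.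
Qed.

(* The family a|b: nass A B (X ⊗ Y) is invertible, so the defining equation
   [bar_spec] has a unique solution, written out here. *)
Definition bar (A B : nuc_ob) (X Y : G) :
    iso ((nob A ⊗ nob B) ⊗ (X ⊗ Y)) (((nob A ⊗ nob B) ⊗ X) ⊗ Y) :=
  iso_comp (iso_comp (iso_comp
    (iso_tens (nass A B X) (iso_id Y))
    (nass A (B ⊗ X) Y))
    (iso_tens (iso_id (nob A)) (nass B X Y)))
    (iso_sym (nass A B (X ⊗ Y))).

Lemma bar_spec (A B : nuc_ob) (X Y : G) :
  bar A B X Y ∘ nass A B (X ⊗ Y)
  = (nass A B X ⊠ idm Y) ∘ nass A (B ⊗ X) Y ∘ (idm (nob A) ⊠ nass B X Y).
Proof. by rewrite /= -[LHS]comp_assoc invK comp_idr. Qed.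

Lemma bar_nat (A A' B B' : nuc_ob) (f : nuc_hom A A') (g : nuc_hom B B')
    (X X' Y Y' : G) (h : hom X X') (k : hom Y Y') :
  bar A' B' X' Y' ∘ ((nfun f ⊠ nfun g) ⊠ (h ⊠ k))
  = (((nfun f ⊠ nfun g) ⊠ h) ⊠ k) ∘ bar A B X Y.
Proof.
apply: (@iso_epi _ _ _ _ (nass A B (X ⊗ Y))).
rewrite -[RHS]comp_assoc bar_spec -comp_assoc -nuc_nat comp_assoc bar_spec.
rewrite -!comp_assoc tens_comp nuc_nat comp_idl -{1}(comp_idr (nfun f)).
rewrite -tens_comp.
rewrite (comp_assoc (nass A' (B' ⊗ X') Y')) nuc_nat.
rewrite !comp_assoc !tens_comp nuc_nat.
by rewrite comp_idl comp_idr.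
Qed.

Definition nuc_tens_ob (A B : nuc_ob) : nuc_ob.
Proof.
refine (@NucOb (nob A ⊗ nob B) (bar A B) _).
move=> X X' Y Y' h k; rewrite -tens_id.
exact: (bar_nat (nuc_id A) (nuc_id B)).
Defined.

Definition nuc_tens_hom (A A' B B' : nuc_ob)
    (f : nuc_hom A A') (g : nuc_hom B B') :
  nuc_hom (nuc_tens_ob A B) (nuc_tens_ob A' B').
Proof.
refine (@NucHom (nuc_tens_ob A B) (nuc_tens_ob A' B') (nfun f ⊠ nfun g) _).
move=> X Y; have := bar_nat f g (idm X) (idm Y).
by rewrite tens_id => e; symmetry.
Defined.

Definition nuc_tensor : functor (prod_category nuc_category nuc_category) nuc_category.
Proof.
refine (@Functor (prod_category nuc_category nuc_category) nuc_category
  (fun AB => nuc_tens_ob (fst AB) (snd AB))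
  (fun AB AB' fg => nuc_tens_hom (fst fg) (snd fg)) _ _).
- by move=> [A B]; apply: nuc_hom_ext => /=; apply: tens_id.
- move=> [A B] [A' B'] [A'' B''] [f' g'] [f g]; apply: nuc_hom_ext => /=.
  by rewrite tens_comp.
Defined.

Definition nuc_magmoidal : magmoidal := Magmoidal nuc_tensor.

Lemma nuc_assocP (A B C : nuc_ob) (X Y : G) :
  ((nass A B C ⊠ idm X) ⊠ idm Y) ∘ bar A (nuc_tens_ob B C) X Y
  = bar (nuc_tens_ob A B) C X Y ∘ (nass A B C ⊠ idm (X ⊗ Y)).
Proof.
apply: (@iso_epi _ _ _ _ (nass A (nuc_tens_ob B C) (X ⊗ Y))).
apply: (@iso_epi _ _ _ _ (iso_tens (iso_id (nob A)) (nass B C (X ⊗ Y)))).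
rewrite -2![LHS]comp_assoc.
rewrite (comp_assoc (bar A _ X Y)) (bar_spec A (nuc_tens_ob B C) X Y).
rewrite -[in LHS](comp_assoc _ _ (iso_tens _ _)).
have eL : (idm (nob A) ⊠ bar B C X Y) ∘ (idm (nob A) ⊠ nass B C (X ⊗ Y))
    = (idm (nob A) ⊠ (nass B C X ⊠ idm Y))
      ∘ ((idm (nob A) ⊠ nass B (C ⊗ X) Y)
         ∘ (idm (nob A) ⊠ (idm (nob B) ⊠ nass C X Y))).
  by rewrite !tens_comp bar_spec !comp_idl comp_assoc.
have eN : nass A (nuc_tens_ob B C ⊗ X) Y ∘ (idm (nob A) ⊠ (nass B C X ⊠ idm Y))
    = ((idm (nob A) ⊠ nass B C X) ⊠ idm Y) ∘ nass A (B ⊗ (C ⊗ X)) Y.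
  exact: nass_nat.
transitivity ((((nass A B C ⊠ idm X) ∘ nass A (B ⊗ C) X
                ∘ (idm (nob A) ⊠ nass B C X)) ⊠ idm Y)
    ∘ nass A (B ⊗ (C ⊗ X)) Y
    ∘ ((idm (nob A) ⊠ nass B (C ⊗ X) Y)
       ∘ (idm (nob A) ⊠ (idm (nob B) ⊠ nass C X Y)))).
  rewrite [X in _ ∘ (_ ∘ X) = _]eL -[X in _ ∘ X = _]comp_assoc.
  rewrite (comp_assoc (nass A (nuc_tens_ob B C ⊗ X) Y)) eN.
  by rewrite !comp_assoc !tens_comp !comp_idl.
rewrite -[X in _ = X ∘ _]comp_assoc -[RHS]comp_assoc.
rewrite -[X in _ = _ ∘ X](bar_spec A B C (X ⊗ Y)).
rewrite [RHS]comp_assoc (bar_spec (nuc_tens_ob A B) C X Y).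
have e1 : (idm (nob A ⊗ nob B) ⊠ nass C X Y) ∘ nass A B (C ⊗ (X ⊗ Y))
    = nass A B ((C ⊗ X) ⊗ Y) ∘ (idm (nob A) ⊠ (idm (nob B) ⊠ nass C X Y)).
  by rewrite -tens_id nass_nat.
rewrite -[RHS]comp_assoc [X in _ = _ ∘ X]e1 [RHS]comp_assoc.
rewrite -[X in _ = X ∘ _]comp_assoc.
rewrite [X in _ = _ ∘ X ∘ _](bar_spec A B (C ⊗ X) Y).
rewrite !comp_assoc [X in _ = X ∘ _ ∘ _ ∘ _]tens_comp.
by rewrite [X in _ = (X ⊠ _) ∘ _ ∘ _ ∘ _](bar_spec A B C X) comp_idl.
Qed.

Definition nuc_assoc (A B C : nuc_magmoidal) :
  iso (A ⊗ (B ⊗ C)) ((A ⊗ B) ⊗ C).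
Proof.
refine (@Iso nuc_magmoidal _ _
  (@NucHom (nuc_tens_ob A (nuc_tens_ob B C)) (nuc_tens_ob (nuc_tens_ob A B) C)
     (nass A B C) (nuc_assocP A B C))
  (@NucHom (nuc_tens_ob (nuc_tens_ob A B) C) (nuc_tens_ob A (nuc_tens_ob B C))
     (inv (nass A B C)) _) _ _).
- by apply: nuc_hom_ext => /=; apply: invK.
- by apply: nuc_hom_ext => /=; apply: fwdK.
Unshelve.
move=> X Y.
exact: (@inv_nat _ _ _ _ _
  (iso_tens (nass A B C) (iso_id (X ⊗ Y)))
  (iso_tens (iso_tens (nass A B C) (iso_id X)) (iso_id Y))
  _ _ (nuc_assocP A B C X Y)).
Defined.

Definition nucleus : semigroupal.
Proof.
refine (@Semigroupal nuc_magmoidal nuc_assoc _ _).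
- move=> A A' B B' C C' f g h; apply: nuc_hom_ext => /=.
  exact: nuc_nat.
- move=> A B C D; apply: nuc_hom_ext; exact: bar_spec.
Defined.

Definition tens_left (A : G) : functor G G.
Proof.
refine (@Functor G G (fun X => A ⊗ X) (fun X Y f => idm A ⊠ f) _ _).
- by move=> X; apply: tens_id.
- by move=> X Y Z g f; rewrite tens_comp comp_idl.
Defined.

Definition tens_left_nat (A B : G) (f : hom A B) :
  nat_trans (tens_left A) (tens_left B).
Proof.
refine (@NatTrans G G (tens_left A) (tens_left B) (fun X => f ⊠ idm X) _).
by move=> X Y g /=; rewrite !tens_comp !comp_idl !comp_idr.
Defined.

Definition nucleus_L : functor nucleus (End_semigroupal G).
Proof.
refine (@Functor nucleus (End_semigroupal G)
  (fun A => tens_left (nob A)) (fun A B f => tens_left_nat (nfun f)) _ _).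
- by move=> A; apply: nat_trans_ext => X /=; apply: tens_id.
- move=> A B C g f; apply: nat_trans_ext => X /=.
  by rewrite tens_comp comp_idl.
Defined.

Definition nucleus_L2 (A B : nucleus) :
  hom (nucleus_L (A ⊗ B)) (nucleus_L A ⊗ nucleus_L B).
Proof.
refine (@NatTrans G G (tens_left (nob A ⊗ nob B))
  (functor_comp (tens_left (nob A)) (tens_left (nob B)))
  (fun X => inv (nass A B X)) _).
move=> X Y f; apply: inv_nat => /=.
by rewrite -tens_id nass_nat.
Defined.

End LeftNucleus.

(* Main.v *)
(* All components of the constraints are built from the inverses of the nucleus
   isomorphisms. Naturality is the inverse of naturality of [nass] along nucleus
   morphisms; coherence is the inverse of the equation defining a|b, because the
   constraint of End(G) is the identity. *)
From Corelib Require Import ssreflect.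
Require Import Defs.
Local Open Scope cat_scope.

Theorem proposition2p5p1 (G : magmoidal) :
  is_semigroupal_functor (@nucleus_L G) (@nucleus_L2 G).
Proof.
split.
- move=> A A' B B' f g; apply: nat_trans_ext => X /=.
  (* This trades the inverses for [nass]; interchange then merges the horizontal composite of [L(f)]
     and [L(g)] into [f ⊠ (g ⊠ idm X)]. *)
  apply: inv_nat.
  by rewrite tens_comp comp_idr comp_idl nuc_nat.
- move=> A B; unshelve eexists.
    (* The inverse transformation is [nass] itself with its middle argument fixed at [nob B]. *)
    refine (@NatTrans G G
      (functor_comp (tens_left (nob A)) (tens_left (nob B)))
      (tens_left (nob A ⊗ nob B)) (fun X => nass A (nob B) X) _).
    by move=> X Y f /=; rewrite nass_nat tens_id.
  by split; apply: nat_trans_ext => X /=; [apply: fwdK | apply: invK].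
- move=> A B C; apply: nat_trans_ext => X /=.
  (* The inverse of [bar A B C X] has four factors: the last cancels against [nass A B C ⊠ idm X],
     the first against [inv (nass A B (C ⊗ X))]. The middle two form the left side. *)
  rewrite !tens_id !comp_idl comp_idr -!comp_assoc.
  rewrite tens_comp invK comp_idl tens_id comp_idr.
  by rewrite (comp_assoc (inv _) (fwd _)) invK comp_idl.
Qed.
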